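(* Let $g\in\mathscr{L}$, let $\mathbb{A}=(A_1,\ldots,A_n)$ be an $n$-tuple of positive definite matrices in $\mathcal{M}_k$ and let $w=(w_1,\ldots,w_n)$ be a weight vector. Then, for any $x\in\mathbb{C}^k$, $$\left\langle\sigma_g(w;\mathbb{A})x,x\right\rangle\le \sigma_g\left(w;\langle\mathbb{A}x,x\rangle\right),$$ where $\langle\mathbb{A}x,x\rangle=(\langle A_1x,x\rangle,\ldots,\langle A_nx,x\rangle)$, regarded for $x\neq0$ as an $n$-tuple of positive $1\times1$ matrices, and where for $x=0$ the right-hand side is interpreted as $0$.
   Context: $\mathcal{M}_k$ is the algebra of complex $k\times k$ matrices. A weight vector is $w=(w_1,\ldots,w_n)$ with all $w_i>0$ and $\sum_{i=1}^n w_i=1$. $\mathscr{L}$ is the set of all operator monotone functions $g$ on $(0,\infty)$ (real-valued functions, applied to positive definite matrices by functional calculus, with $A\le B\Rightarrow g(A)\le g(B)$ for positive definite matrices of every size, where $A\le B$ means $B-A$ is positive semidefinite) satisfying $g(1)=0$ and $g'(1)=1$. For $g\in\mathscr{L}$, a weight vector $w$ and positive definite matrices $\mathbb{A}=(A_1,\ldots,A_n)$ of a common size, $\sigma_g(w;\mathbb{A})$ denotes the (unique) positive definite solution $X$ of the generalized Karcher equation $\sum_{i=1}^{n}w_i\,g\left(X^{-1/2}A_iX^{-1/2}\right)=0$. In particular, for positive numbers $a_1,\ldots,a_n$, $\sigma_g(w;(a_1,\ldots,a_n))$ is the unique $X>0$ with $\sum_{i=1}^n w_i\,g(a_i/X)=0$.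 *)

(* Defs.v *)
From HB Require Import structures.
From mathcomp Require Import all_boot all_order all_algebra.
From mathcomp.real_closed Require Export complex.
From mathcomp Require Import all_classical all_reals all_analysis.
Set Implicit Arguments.
Unset Strict Implicit.
Unset Printing Implicit Defensive.
Import Order.TTheory GRing.Theory Num.Theory.
Import numFieldNormedType.Exports.
Local Open Scope complex_scope.
Local Open Scope classical_set_scope.
Local Open Scope ring_scope.

Definition inner (R : realType) k (u v : 'cV[R[i]]_k) : R[i] :=
  dotmx u^T v^T.

(* [<=] and [<] on [R[i]] compare numbers with equal imaginary parts, so
   [0 <= z] also says that [z] is real. *)
Definition psdmx (R : realType) k (A : 'M[R[i]]_k) : Prop :=
  A \is hermsymmx /\ forall x : 'cV[R[i]]_k, 0 <= inner (A *m x) x.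

Definition posdefmx (R : realType) k (A : 'M[R[i]]_k) : Prop :=
  A \is hermsymmx /\ forall x : 'cV[R[i]]_k, x != 0 -> 0 < inner (A *m x) x.

Definition loewner (R : realType) k (A B : 'M[R[i]]_k) : Prop := psdmx (B - A).

(* Meant for Hermitian [A]: then [A = P^-1 *m diag_mx d *m P] with [d] real and
   [P] unitary, and the result does not depend on the diagonalization. *)
Definition fcalc (R : realType) k (f : R -> R) (A : 'M[R[i]]_k) : 'M[R[i]]_k :=
  invmx (spectralmx A)
    *m diag_mx (map_mx (fun z : R[i] => (f (complex.Re z))%:C) (spectral_diag A))
    *m spectralmx A.

Definition invsqrtmx (R : realType) k (X : 'M[R[i]]_k) : 'M[R[i]]_k :=
  fcalc (fun t : R => (Num.sqrt t)^-1) X.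

(* A function on (0, oo) is a function on [R] whose other values are
   irrelevant: below, it is applied to positive definite matrices only. *)
Definition operator_monotone (R : realType) (g : R -> R) : Prop :=
  forall m (A B : 'M[R[i]]_m), posdefmx A -> posdefmx B ->
    loewner A B -> loewner (fcalc g A) (fcalc g B).

Definition classL (R : realType) : set (R -> R) :=
  [set g | [/\ operator_monotone g, g 1 = 0 & is_derive (1 : R) (1 : R) g (1 : R)]].

Definition weight_vector (R : realType) n (w : 'I_n -> R) : Prop :=
  (forall i, 0 < w i) /\ \sum_(i < n) w i = 1.

Definition karcher_solution (R : realType) n k (g : R -> R) (w : 'I_n -> R)
    (A : 'I_n -> 'M[R[i]]_k) : set 'M[R[i]]_k :=
  [set X | posdefmx X /\
    \sum_(i < n) (w i)%:C *: fcalc g (invsqrtmx X *m A i *m invsqrtmx X) = 0].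

(* For [g] in [classL], [w] a weight vector and [A] positive definite there is
   exactly one Karcher solution, so that the default value 0 is not used. *)
Definition sigma (R : realType) n k (g : R -> R) (w : 'I_n -> R)
    (A : 'I_n -> 'M[R[i]]_k) : 'M[R[i]]_k :=
  xget 0 (karcher_solution g w A).

(* Positive numbers are regarded as positive definite 1 x 1 matrices. *)
Definition sigma_num (R : realType) n (g : R -> R) (w : 'I_n -> R)
    (a : 'I_n -> R[i]) : R[i] :=
  sigma g w (fun i => (a i)%:M : 'M[R[i]]_1) 0 0.

(* Main.v *)
(* Rotating diag(a, b) by the angle whose squared cosine is t gives a 2 x 2
   matrix with corner entry c0 = t a + (1 - t) b, which lies below diag(c, M)
   when c > c0 and M is large; operator monotonicity, read off at the corner,
   gives t g(a) + (1 - t) g(b) <= g(c). Hence g is continuous and concave on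
   (0, oo), and Jensen's inequality holds for quadratic forms: if |y|^2 = s, then
   <g(B)y, y> <= s g(<By, y> / s).
   Let X solve the matrix equation and put y = X^(1/2) x, B_i = X^(-1/2) A_i
   X^(-1/2), so that <B_i y, y> = <A_i x, x> =: a_i and s = <Xx, x>. Applying
   Jensen to the equation yields sum_i w_i g(a_i / s) >= 0. As a function of s
   this sum decreases and vanishes at the scalar solution, so s is at most that
   solution. *)
Require Import Defs.
From mathcomp Require Import all_boot all_order all_algebra.
From mathcomp Require Import all_classical all_reals all_analysis.
From mathcomp Require Import ring lra.
Import Order.TTheory GRing.Theory Num.Theory numFieldNormedType.Exports.
Local Open Scope complex_scope.
Local Open Scope classical_set_scope.
Local Open Scope ring_scope.
Local Open Scope sesquilinear_scope.
Set Implicit Arguments.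
Unset Strict Implicit.

(** * Unitary diagonalization *)

Section UnitaryDiagonalization.
Context {C : numClosedFieldType} {k : nat}.
Implicit Types (V W : 'M[C]_k) (d e : 'rV[C]_k).

Lemma unitary_adjmxK V : V \is unitarymx -> V^t* *m V = 1%:M.
Proof. by move=> /unitarymxP/mulmx1C. Qed.

Lemma unitary_diag_adjoint V d :
  (V^t* *m diag_mx d *m V)^t* = V^t* *m diag_mx (map_mx Num.conj d) *m V.
Proof.
by rewrite !trmx_mul !map_mxM /= trmxCK tr_diag_mx map_diag_mx mulmxA.
Qed.

Lemma hermitian_spectral (A : 'M[C]_k) : A \is hermsymmx ->
  A = (spectralmx A)^t* *m diag_mx (spectral_diag A) *m spectralmx A.
Proof.
move=> /hermitian_normalmx/orthomx_spectralP {1}->.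
by rewrite invmx_unitary ?spectral_unitarymx.
Qed.

(* The transition matrix [Z = W V^*] intertwines the diagonal matrices, so that
   [Z a b] vanishes unless [d b = e a]. *)
Lemma unitary_diag_map (f : C -> C) V W d e :
  V \is unitarymx -> W \is unitarymx ->
  V^t* *m diag_mx d *m V = W^t* *m diag_mx e *m W ->
  V^t* *m diag_mx (map_mx f d) *m V = W^t* *m diag_mx (map_mx f e) *m W.
Proof.
move=> Vu Wu VW.
have : W *m V^t* *m diag_mx d = diag_mx e *m (W *m V^t*).
  have := congr1 (fun M => W *m M *m V^t*) VW.
  rewrite -!mulmxA (unitarymxP Vu) mulmx1 => ->.
  by rewrite [W *m (W^t* *m _)]mulmxA (unitarymxP Wu) mul1mx.
move=> /matrixP h.
have key : W *m V^t* *m diag_mx (map_mx f d)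
    = diag_mx (map_mx f e) *m (W *m V^t*).
  apply/matrixP => a b; have := h a b.
  rewrite !mul_mx_diag !mul_diag_mx !mxE; set z := \sum_(_ | _) _ => hz.
  have [->|z0] := eqVneq z 0; first by rewrite mulr0 mul0r.
  by move: hz; rewrite mulrC => /(mulIf z0) <-; rewrite mulrC.
have := congr1 (fun M => W^t* *m M *m V) key.
rewrite !mulmxA (unitary_adjmxK Wu) mul1mx => ->.
by rewrite -!mulmxA (unitary_adjmxK Vu) mulmx1.
Qed.

End UnitaryDiagonalization.

(** * Quadratic forms and functional calculus in an eigenbasis *)

Definition sqmod (R : realType) (z : R[i]) : R :=
  complex.Re z ^+ 2 + complex.Im z ^+ 2.

Lemma sqmod_ge0 (R : realType) (z : R[i]) : 0 <= sqmod z.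
Proof. by rewrite addr_ge0 ?sqr_ge0. Qed.

Lemma sqmod_eq0 (R : realType) (z : R[i]) : (sqmod z == 0) = (z == 0).
Proof. by rewrite /sqmod paddr_eq0 ?sqr_ge0 // !sqrf_eq0 eq_complex. Qed.

Lemma conjC_mul (R : realType) (z : R[i]) : Num.conj z * z = (sqmod z)%:C.
Proof. by rewrite mulrC -normCK -add_Re2_Im2. Qed.

Lemma conj_real_complex (R : realType) (r : R) : Num.conj r%:C = r%:C.
Proof. by apply/CrealP; apply/complex_realP; exists r. Qed.

(** For unitary [V], the Hermitian matrix with eigenvalues [d] and eigenvectors the columns of
    [V^t*]. Keeping [V] free of [spectralmx] allows explicit rotations, and real [d] turns quadratic
    forms into real sums. *)
Definition udiag (R : realType) k (V : 'M[R[i]]_k) (d : 'I_k -> R) :=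
  V^t* *m diag_mx (\row_j (d j)%:C) *m V.

Lemma innerE (R : realType) k (u v : 'cV[R[i]]_k) :
  inner u v = (v^t* *m u) 0 0.
Proof.
rewrite /inner dotmxE !mxE; apply: eq_bigr => j _.
by rewrite !mxE mulrC.
Qed.

Lemma inner_mulmxl (R : realType) k (M : 'M[R[i]]_k) (u v : 'cV[R[i]]_k) :
  inner (M *m u) v = inner u (M^t* *m v).
Proof. by rewrite !innerE trmx_mul map_mxM trmxCK mulmxA. Qed.

Lemma inner_self (R : realType) k (x : 'cV[R[i]]_k) :
  inner x x = (\sum_j sqmod (x j 0))%:C.
Proof.
rewrite innerE !mxE rmorph_sum; apply: eq_bigr => j _.
by rewrite !mxE conjC_mul.
Qed.

Lemma inner_udiag (R : realType) k (V : 'M[R[i]]_k) d (x : 'cV[R[i]]_k) :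
  inner (udiag V d *m x) x = (\sum_j d j * sqmod ((V *m x) j 0))%:C.
Proof.
rewrite /udiag -!mulmxA inner_mulmxl trmxCK innerE mulmxA -map_trmx.
rewrite -mulmxA mul_diag_mx !mxE rmorph_sum; apply: eq_bigr => j _.
by rewrite !mxE mulrCA conjC_mul rmorphM.
Qed.

Lemma sum_sqmod_unitary (R : realType) k (V : 'M[R[i]]_k) (x : 'cV[R[i]]_k) :
  V \is unitarymx ->
  \sum_j sqmod ((V *m x) j 0) = \sum_j sqmod (x j 0).
Proof.
move=> Vu; apply: (@complexI R); rewrite -!inner_self inner_mulmxl mulmxA.
by rewrite (mulmx1C (unitarymxP Vu)) mul1mx.
Qed.

Lemma sum_sqmod_gt0 (R : realType) k (x : 'cV[R[i]]_k) :
  x != 0 -> 0 < \sum_j sqmod (x j 0).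
Proof.
move=> x0; rewrite lt_def sumr_ge0 ?andbT; last by move=> j _; apply: sqmod_ge0.
apply: contra x0; rewrite psumr_eq0; last by move=> j _; apply: sqmod_ge0.
move=> /allP h; apply/eqP/matrixP => j l; rewrite ord1 !mxE.
by apply/eqP; rewrite -sqmod_eq0; apply: (implyP (h j _)); rewrite ?mem_index_enum.
Qed.

Lemma udiag_herm (R : realType) k (V : 'M[R[i]]_k) d :
  udiag V d \is hermsymmx.
Proof.
rewrite is_hermitianmxE expr0 scale1r; apply/eqP.
rewrite [RHS]unitary_diag_adjoint.
suff -> : map_mx Num.conj (\row_j (d j)%:C) = \row_j (d j)%:C by [].
by apply/matrixP => a b; rewrite !mxE conj_real_complex.
Qed.

Lemma posdef_udiag (R : realType) k (V : 'M[R[i]]_k) d :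
  V \is unitarymx -> (forall j, 0 < d j) -> posdefmx (udiag V d).
Proof.
move=> Vu d0; split=> [|x x0]; first exact: udiag_herm.
rewrite inner_udiag ltcR.
have /sum_sqmod_gt0 : V *m x != 0.
  by apply: contra x0 => /eqP Vx; rewrite -(mulKmx (unitarymx_unit Vu) x) Vx mulmx0.
rewrite !lt_def => /andP[n0 _]; rewrite sumr_ge0 ?andbT; last first.
  by move=> j _; rewrite mulr_ge0 ?sqmod_ge0 // ltW.
apply: contra n0; rewrite !psumr_eq0; first last.
- by move=> j _; rewrite mulr_ge0 ?sqmod_ge0 // ltW.
- by move=> j _; apply: sqmod_ge0.
move=> /allP h; apply/allP => j jP; have := h j jP => /=.
by rewrite mulf_eq0 gt_eqF.
Qed.

Lemma posdef_udiagP (R : realType) k (A : 'M[R[i]]_k) : posdefmx A ->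
  exists V, exists2 d, V \is unitarymx & A = udiag V d /\ forall j, 0 < d j.
Proof.
move=> [Ah Ap]; have Vu := spectral_unitarymx A.
have Ar := hermitian_spectral_diag_real Ah.
have AE : A = udiag (spectralmx A) (fun j => complex.Re (spectral_diag A 0 j)).
  have dE : spectral_diag A = \row_j (complex.Re (spectral_diag A 0 j))%:C.
    apply/matrixP => a b; rewrite ord1 !mxE.
    by rewrite RRe_real //; apply: (mxOverP Ar).
  by rewrite /udiag -dE; exact: hermitian_spectral.
exists (spectralmx A), (fun j => complex.Re (spectral_diag A 0 j)) => //.
split=> // j.
(* The [j]-th eigenvector: its coordinates in the eigenbasis are those of [delta_mx j 0], so the
   form takes the value [d j] there. *)
have x0 : (spectralmx A)^t* *m (delta_mx j 0 : 'cV_k) != 0.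
  apply/negP => /eqP /(congr1 (mulmx (spectralmx A))).
  rewrite mulmx0 mulmxA (unitarymxP Vu) mul1mx => /matrixP/(_ j 0).
  by rewrite !mxE !eqxx => /eqP; rewrite oner_eq0.
have := Ap _ x0; rewrite {1}AE inner_udiag ltcR mulmxA (unitarymxP Vu) mul1mx.
rewrite (bigD1 j) //= big1 => [|l lj].
  by rewrite !mxE !eqxx /sqmod /= expr1n expr0n /= !addr0 mulr1.
by rewrite !mxE (negbTE lj) /sqmod /= expr0n /= addr0 mulr0.
Qed.

(** Frees [fcalc] from the diagonalization picked by [spectralmx]: by [unitary_diag_map], every
    unitary diagonalization gives the same result. *)
Lemma fcalc_udiag (R : realType) k (f : R -> R) (V : 'M[R[i]]_k) d :
  V \is unitarymx -> fcalc f (udiag V d) = udiag V (f \o d).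
Proof.
move=> Vu; set A := udiag V d.
have Ah : A \is hermsymmx by apply: udiag_herm.
rewrite /fcalc invmx_unitary ?spectral_unitarymx //.
rewrite -(unitary_diag_map _ Vu (spectral_unitarymx A) (hermitian_spectral Ah)).
set fd := map_mx (fun z : R[i] => (f (complex.Re z))%:C) _.
suff -> : fd = \row_j (f (d j))%:C by [].
by apply/matrixP => a b; rewrite !mxE.
Qed.

Lemma unitarymx1 (R : realType) k : (1%:M : 'M[R[i]]_k) \is unitarymx.
Proof. by apply/unitarymxP; rewrite trmx1 map_mx1 mulmx1. Qed.

Lemma loewner_udiagP (R : realType) k (V W : 'M[R[i]]_k) d e :
  loewner (udiag V d) (udiag W e) <->
  forall x : 'cV_k, \sum_j d j * sqmod ((V *m x) j 0)
                      <= \sum_j e j * sqmod ((W *m x) j 0).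
Proof.
have innerB x : inner ((udiag W e - udiag V d) *m x) x =
    (\sum_j e j * sqmod ((W *m x) j 0)
       - \sum_j d j * sqmod ((V *m x) j 0))%:C.
  rewrite rmorphB /= -!inner_udiag !innerE mulmxBl mulmxBr.
  by rewrite [LHS]mxE; congr (_ + _); rewrite mxE.
rewrite /loewner /psdmx; split=> [[_ h] x|h].
  by have := h x; rewrite innerB ler0c subr_ge0.
split=> [|x]; last by rewrite innerB ler0c subr_ge0.
rewrite is_hermitianmxE expr0 scale1r; apply/eqP.
rewrite linearB map_mxB /=; congr (_ - _).
  by have /is_hermitianmxP := udiag_herm W e; rewrite expr0 scale1r.
by have /is_hermitianmxP := udiag_herm V d; rewrite expr0 scale1r.
Qed.

Lemma operator_monotone_udiag (R : realType) (g : R -> R) k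
    (V W : 'M[R[i]]_k) d e :
  operator_monotone g -> V \is unitarymx -> W \is unitarymx ->
  (forall j, 0 < d j) -> (forall j, 0 < e j) ->
  (forall x : 'cV_k, \sum_j d j * sqmod ((V *m x) j 0)
                       <= \sum_j e j * sqmod ((W *m x) j 0)) ->
  forall x : 'cV_k, \sum_j g (d j) * sqmod ((V *m x) j 0)
                      <= \sum_j g (e j) * sqmod ((W *m x) j 0).
Proof.
move=> gm Vu Wu d0 e0 /loewner_udiagP/(gm _ _ _ (posdef_udiag Vu d0)).
move=> /(_ (posdef_udiag Wu e0)).
by rewrite !fcalc_udiag // => /loewner_udiagP.
Qed.

(** * Continuity and concavity of operator monotone functions *)

(** Young's inequality with parameter [eta] absorbs the cross terms; then [a * q ^+ 2 + b * p ^+ 2]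
    is bounded by [a + b]. The result puts the rotated diag(a, b) below a diagonal matrix. *)
Lemma rotated_form_le (R : realType) (a b p q eta x y : R) :
  0 <= a -> 0 <= b -> 0 < eta -> p ^+ 2 + q ^+ 2 = 1 ->
  a * (p * x + q * y) ^+ 2 + b * (q * x - p * y) ^+ 2
    <= (1 + eta) * (a * p ^+ 2 + b * q ^+ 2) * x ^+ 2
       + (1 + eta^-1) * (a + b) * y ^+ 2.
Proof.
move=> a0 b0 eta0 pq.
have sq u v : (u + v) ^+ 2 <= (1 + eta) * u ^+ 2 + (1 + eta^-1) * v ^+ 2.
  rewrite -subr_ge0.
  have -> : (1 + eta) * u ^+ 2 + (1 + eta^-1) * v ^+ 2 - (u + v) ^+ 2
      = eta * (u - v / eta) ^+ 2 by field; rewrite gt_eqF.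
  by rewrite mulr_ge0 ?sqr_ge0 // ltW.
apply: le_trans (lerD (ler_wpM2l a0 (sq _ _)) (ler_wpM2l b0 (sq _ _))) _.
rewrite -subr_ge0 [leRHS](_ : _ = (1 + eta^-1) * (a * (1 - q ^+ 2)
    + b * (1 - p ^+ 2)) * y ^+ 2); last by ring.
have -> : 1 - q ^+ 2 = p ^+ 2 by rewrite -pq addrK.
have -> : 1 - p ^+ 2 = q ^+ 2 by rewrite -pq addrC addKr.
apply: mulr_ge0 (sqr_ge0 _); apply: mulr_ge0.
  by rewrite addr_ge0 // invr_ge0 ltW.
by rewrite addr_ge0 // mulr_ge0 // sqr_ge0.
Qed.

(** The strict gap between [c] and the convex combination pays for the off-diagonal entries of the
    rotated matrix. *)
Lemma operator_monotone_concave_gt (R : realType) (g : R -> R) (a b t c : R) :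
  operator_monotone g -> 0 < a -> 0 < b -> 0 <= t <= 1 ->
  t * a + (1 - t) * b < c -> t * g a + (1 - t) * g b <= g c.
Proof.
move=> gm a0 b0 /andP[t0 t1] ltc.
set c0 := t * a + (1 - t) * b in ltc.
have c00 : 0 < c0.
  rewrite /c0; have [->|tn0] := eqVneq t 0; first by rewrite mul0r add0r subr0 mul1r.
  rewrite ltr_pwDl // ?mulr_gt0 ?mulr_ge0 ?subr_ge0 // ?ltW //.
  by rewrite lt_def tn0.
(* Chosen so that the two coefficients in [rotated_form_le] become [c] and [M]. *)
pose eta := (c - c0) / c0.
have eta0 : 0 < eta by rewrite divr_gt0 // subr_gt0.
have cE : (1 + eta) * c0 = c by rewrite /eta; field; rewrite gt_eqF.
pose M := (1 + eta^-1) * (a + b).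
have M0 : 0 < M by rewrite mulr_gt0 // addr_gt0 // invr_gt0.
pose p : R := Num.sqrt t; pose q : R := Num.sqrt (1 - t).
have pp : p ^+ 2 = t by rewrite sqr_sqrtr.
have qq : q ^+ 2 = 1 - t by rewrite sqr_sqrtr ?subr_ge0.
have pq1 : p ^+ 2 + q ^+ 2 = 1 by rewrite pp qq addrC subrK.
(* A symmetric orthogonal matrix with rows (p, q) and (q, -p); conjugating diag(a, b) by it puts
   [c0] in the corner. *)
pose V : 'M[R[i]]_2 := \matrix_(j, l)
  (if j == 0 then if l == 0 then p else q else if l == 0 then q else - p)%:C.
have Vu : V \is unitarymx.
  apply/unitarymxP/matrixP => j l; rewrite !mxE !big_ord_recl big_ord0 !mxE /=.
  rewrite !conj_real_complex -!rmorphM addr0 -rmorphD.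
  case: j => [[|[|//]] jP]; case: l => [[|[|//]] lP] /=.
  - by rewrite -!expr2 pq1.
  - by rewrite mulrN mulrC subrr.
  - by rewrite mulNr mulrC subrr.
  - by rewrite mulrNN -!expr2 addrC pq1.
have Iu := unitarymx1 R 2.
pose d (j : 'I_2) := if j == 0 then a else b.
pose e (j : 'I_2) := if j == 0 then c else M.
have d0 j : 0 < d j by rewrite /d; case: ifP.
have e0 j : 0 < e j by rewrite /e; case: ifP => // _; apply: lt_trans ltc.
have Vx (x : 'cV[R[i]]_2) j : (V *m x) j 0 = V j 0 * x 0 0 + V j 1 * x 1 0.
  rewrite mxE !big_ord_recl big_ord0 addr0.
  by congr (_ + V j _ * x _ 0); apply: val_inj.
have sum2 (f : 'I_2 -> R) : \sum_j f j = f 0 + f 1.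
  by rewrite !big_ord_recl big_ord0 addr0; congr (_ + f _); apply: val_inj.
have le_de (x : 'cV_2) : \sum_j d j * sqmod ((V *m x) j 0)
                           <= \sum_j e j * sqmod ((1%:M *m x) j 0).
  rewrite mul1mx !sum2 !Vx !mxE /= /d /e /= /sqmod.
  case: (x 0 0) (x 1 0) => [x1 x2] [y1 y2] /=.
  (* Since [V] is real, the form splits into one real form in the real parts and one in the
     imaginary parts. *)
  have := lerD (rotated_form_le x1 y1 (ltW a0) (ltW b0) eta0 pq1)
               (rotated_form_le x2 y2 (ltW a0) (ltW b0) eta0 pq1).
  have -> : a * p ^+ 2 + b * q ^+ 2 = c0 by rewrite pp qq /c0; ring.
  by rewrite cE -/M; lra.
(* The first basis vector reads off the corner entries of both sides. *)
have := operator_monotone_udiag gm Vu Iu d0 e0 le_de (delta_mx 0 0).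
rewrite mul1mx !sum2 !Vx !mxE /= /d /e /sqmod /=.
rewrite ?mulr1 ?mulr0 ?subr0 ?addr0 ?add0r ?expr0n ?expr1n /=.
by rewrite pp qq; lra.
Qed.

Lemma operator_monotone_nondecreasing (R : realType) (g : R -> R) (a b : R) :
  operator_monotone g -> 0 < a -> a <= b -> g a <= g b.
Proof.
move=> gm a0; rewrite le_eqVlt => /predU1P[<-//|ab].
have := @operator_monotone_concave_gt _ g a a 1 b gm a0 a0.
by rewrite ler01 lexx subrr !mul0r !addr0 !mul1r; apply.
Qed.

(* The point [u] lies strictly above a convex combination of [u / 2] and [v], so
   that [operator_monotone_concave_gt] applies before continuity is known. *)
Lemma operator_monotone_lipschitz (R : realType) (g : R -> R) (u v : R) :
  operator_monotone g -> 0 < u -> u < v -> v <= 5 / 4 * u ->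
  g v - g u <= 4 * ((v - u) / u) * (g u - g (u / 2)).
Proof.
move=> gm u0 uv vu; pose r := (v - u) / u.
have r0 : 0 < r by rewrite divr_gt0 ?subr_gt0.
have ru : r * u = v - u by rewrite /r divfK // gt_eqF.
have r4 : r <= 1 / 4 by rewrite /r ler_pdivrMr //; lra.
have gvu : g u <= g v by apply: operator_monotone_nondecreasing => //; exact: ltW.
have gu2 : g (u / 2) <= g u by apply: operator_monotone_nondecreasing => //; lra.
have : 2 * r * g (u / 2) + (1 - 2 * r) * g v <= g u.
  apply: operator_monotone_concave_gt => //; [lra|lra|lra|].
  have -> : v = u + r * u by rewrite ru; lra.
  have := mulr_gt0 r0 (mulr_gt0 r0 u0); nra.
rewrite -/r; nra.
Qed.

Lemma operator_monotone_continuous (R : realType) (g : R -> R) (c : R) :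
  operator_monotone g -> 0 < c -> {for c, continuous g}.
Proof.
move=> gm c0.
have mono := operator_monotone_nondecreasing gm.
(* If [4 / 5 * c <= v <= c], then [2 / 5 * c <= v / 2]; hence [K] dominates both [g c - g (c / 2)]
   and [g v - g (v / 2)]. *)
pose K := g c - g (2 / 5 * c).
have K0 : 0 <= K by rewrite subr_ge0; apply: mono; lra.
(* The range lets [operator_monotone_lipschitz] start from the smaller of [c] and [v]. When that is
   [v], the bound [4 / v <= 5 / c] yields the constant 5. *)
have lip v : 4 / 5 * c <= v <= 5 / 4 * c ->
    `|g c - g v| <= 5 / c * K * `|c - v|.
  move=> /andP[cv vc]; have [vltc|cltv|->] := ltgtP v c; last first.
  - by rewrite !subrr !normr0 mulr0.
  - have gcv : g c <= g v by apply: mono => //; exact: ltW.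
    rewrite ler0_norm ?subr_le0 // ler0_norm ?subr_le0 ?(ltW cltv) // !opprB.
    apply: le_trans (operator_monotone_lipschitz gm c0 cltv vc) _.
    have : g c - g (c / 2) <= K by rewrite lerB //; apply: mono; lra.
    have : 0 <= (v - c) / c by apply: divr_ge0; lra.
    have -> : 5 / c * K * (v - c) = 5 * ((v - c) / c) * K by ring.
    nra.
  - have v0 : 0 < v by lra.
    have gvc : g v <= g c by apply: mono => //; exact: ltW.
    rewrite !ger0_norm ?subr_ge0 ?(ltW vltc) //.
    apply: le_trans (operator_monotone_lipschitz gm v0 vltc _) _; first by lra.
    have : g v - g (v / 2) <= K by rewrite lerB //; apply: mono; lra.
    have : 0 <= g v - g (v / 2) by rewrite subr_ge0; apply: mono; lra.
    have : 0 <= (c - v) / c by apply: divr_ge0; lra.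
    have : 4 * ((c - v) / v) <= 5 * ((c - v) / c).
      rewrite !mulrA ler_pdivrMr // mulrAC ler_pdivlMr //; nra.
    have -> : 5 / c * K * (c - v) = 5 * ((c - v) / c) * K by ring.
    nra.
(* Adding 1 keeps the Lipschitz constant positive when [K = 0], so that it can be divided by. *)
have L0 : 0 < 5 / c * K + 1 by rewrite ltr_wpDl // mulr_ge0 // divr_ge0 // ltW.
apply/cvgrPdist_le => e e0; near=> v.
apply: (@le_trans _ _ ((5 / c * K + 1) * `|c - v|)).
  apply: le_trans (lip v _) _; last by rewrite ler_wpM2r // lerDl.
  apply/andP; split; near: v.
    by apply: lt_le_nbhsr; lra.
  by apply: lt_le_nbhsl; lra.
rewrite mulrC -ler_pdivlMr //; near: v.
have := @cvg_id _ (nbhs c); move=> /cvgrPdist_le; apply.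
by rewrite divr_gt0.
Unshelve. all: by end_near. Qed.

(** The limit of [operator_monotone_concave_gt] from the right: if concavity failed by [e],
    continuity would give a point [c + d / 2] where [g] is below [g c + e], a contradiction. *)
Lemma operator_monotone_concave (R : realType) (g : R -> R) (a b t : R) :
  operator_monotone g -> 0 < a -> 0 < b -> 0 <= t <= 1 ->
  t * g a + (1 - t) * g b <= g (t * a + (1 - t) * b).
Proof.
move=> gm a0 b0 t01; set c := t * a + (1 - t) * b.
have c0 : 0 < c by rewrite /c; nra.
rewrite leNgt; apply/negP; rewrite -subr_gt0; set e := _ - g c => e0.
have := operator_monotone_continuous gm c0.
move=> /cvgrPdist_lt/(_ _ e0)/nbhs_ballP[d /= d0 h].
have := h (c + d / 2); rewrite /ball /= opprD addrA subrr add0r normrN.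
rewrite gtr0_norm ?divr_gt0 // ltr_pdivrMr // ltr_pMr // ltr1n => /(_ isT).
have := @operator_monotone_concave_gt _ g a b t (c + d / 2) gm a0 b0 t01.
rewrite -/c ltrDl divr_gt0 // => /(_ isT) gle.
rewrite ltr_distlC => /andP[_]; rewrite /e; lra.
Qed.

(** * Supergradients, Jensen's inequality and strict growth *)

(** By concavity every secant slope to the right of [c] is at most every secant slope to the left;
    the supremum of the right slopes serves as [m]. *)
Lemma operator_monotone_supergradient (R : realType) (g : R -> R) (c : R) :
  operator_monotone g -> 0 < c ->
  exists m, forall t, 0 < t -> g t <= g c + m * (t - c).
Proof.
move=> gm c0.
have slopes u t : 0 < u -> u < c -> c < t ->
    (g t - g c) / (t - c) <= (g c - g u) / (c - u).
  move=> u0 uc ct.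
  have tu : 0 < t - u by lra.
  have t0 : 0 < t by lra.
  (* The weight of [u] when [c] is written as a convex combination of [u] and [t]. *)
  have r01 : 0 <= (t - c) / (t - u) <= 1.
    by rewrite divr_ge0 ?ler_pdivrMr //=; lra.
  have := operator_monotone_concave gm u0 t0 r01.
  have -> : (t - c) / (t - u) * u + (1 - (t - c) / (t - u)) * t = c.
    by field; rewrite gt_eqF.
  have -> : (t - c) / (t - u) * g u + (1 - (t - c) / (t - u)) * g t
      = ((t - c) * g u + (c - u) * g t) / (t - u) by field; rewrite gt_eqF.
  rewrite ler_pdivrMr // => h.
  rewrite ler_pdivrMr ?subr_gt0 // mulrAC ler_pdivlMr ?subr_gt0 //; lra.
pose S := [set s | exists2 t, c < t & s = (g t - g c) / (t - c)]%classic.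
have S0 : S !=set0 by exists ((g (c + 1) - g c) / (c + 1 - c)), (c + 1); rewrite ?ltrDl.
have Sub u : 0 < u -> u < c -> ubound S ((g c - g u) / (c - u)).
  by move=> u0 uc _ [t ct ->]; exact: slopes.
have c2 : 0 < c / 2 < c by apply/andP; split; lra.
exists (sup S) => t t0; have [tc|ct|->] := ltgtP t c.
- have := ge_sup S0 (Sub t t0 tc); rewrite ler_pdivlMr ?subr_gt0 //; lra.
- have : (g t - g c) / (t - c) <= sup S.
    apply: ub_le_sup; last by exists t.
    by have /andP[] := c2; exists ((g c - g (c / 2)) / (c - c / 2)); exact: Sub.
  rewrite ler_pdivrMr ?subr_gt0 //; lra.
- by rewrite subrr mulr0 addr0.
Qed.

(** Summing the supergradient inequality at the weighted mean [c] cancels the linear terms. The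
    weights are left unnormalized because they will be squared moduli of coordinates. *)
Lemma operator_monotone_jensen (R : realType) (g : R -> R) k (p d : 'I_k -> R) :
  operator_monotone g -> (forall j, 0 <= p j) -> (forall j, 0 < d j) ->
  0 < \sum_j p j ->
  \sum_j p j * g (d j)
    <= (\sum_j p j) * g ((\sum_j p j * d j) / \sum_j p j).
Proof.
move=> gm p0 d0; set s := \sum_j p j => s0; set c := _ / s.
(* Were the numerator 0, all [p j] would vanish since [d j > 0], against [0 < s]. *)
have c0 : 0 < c.
  apply: divr_gt0 => //; rewrite lt_def sumr_ge0 ?andbT => [|j _]; last first.
    by rewrite mulr_ge0 // ltW.
  apply: contraTneq s0 => /psumr_eq0P h; rewrite /s big1 ?ltxx // => j _.
  have /eqP := h (fun j _ => mulr_ge0 (p0 j) (ltW (d0 j))) j isT.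
  by rewrite mulf_eq0 [d j == 0]gt_eqF // orbF => /eqP.
have [m hm] := operator_monotone_supergradient gm c0.
apply: le_trans (ler_sum _ (fun j _ => ler_wpM2l (p0 j) (hm _ (d0 j)))) _.
have -> : \sum_j p j * (g c + m * (d j - c))
    = s * g c + m * (\sum_j p j * d j - s * c).
  rewrite mulrBr !mulr_suml !mulr_sumr -sumrB -big_split /=.
  by apply: eq_bigr => j _; ring.
by rewrite [s * c]mulrC divfK ?gt_eqF // subrr mulr0 addr0.
Qed.

(** Otherwise monotonicity and [g 1 = 0] force [g] to vanish on [1, t], and its derivative at 1
    could not be 1. *)
Lemma classL_gt0 (R : realType) (g : R -> R) (t : R) :
  classL g -> 1 < t -> 0 < g t.
Proof.
move=> [gm g1 dg] t1; rewrite ltNge; apply/negP => gt0.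
have g0 u : 1 <= u <= t -> g u = 0.
  move=> /andP[u1 ut]; apply/eqP; rewrite eq_le -{2}g1.
  rewrite (le_trans (operator_monotone_nondecreasing gm _ ut) gt0) ?(lt_le_trans ltr01) //.
  exact: operator_monotone_nondecreasing.
have : h^-1 *: ((g \o shift 1) (h *: 1) - g 1) @[h --> (0 : R)^'] --> (1 : R).
  by rewrite -[X in _ --> X](@derive_val _ _ _ _ _ _ _ dg); exact: ex_derive.
move=> /cvgrPdist_lt/(_ 1 ltr01)/nbhs_ballP[d /= d0 h].
(* Small enough for the difference quotient estimate, and with [1 + r <= t]. *)
pose r := Num.min (d / 2) (t - 1).
have r0 : 0 < r by rewrite lt_min divr_gt0 // subr_gt0.
have rd : r < d by rewrite gt_min ltr_pdivrMr // ltr_pMr // ltr1n.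
have rt : r <= t - 1 by rewrite ge_min lexx orbT.
have := h r; rewrite /ball /= sub0r normrN gtr0_norm // gt_eqF // => /(_ rd isT).
have -> : r *: (1 : R) = r by exact: mulr1.
rewrite g1 g0 ?subrr ?scaler0 ?subr0 ?normr1 ?ltxx //.
by apply/andP; split; lra.
Qed.

(** A supergradient at [v] has slope at most 0 here, so [0 < g (v + 1) <= g v <= g u]. Thus [g] can
    only be flat where it is positive. *)
Lemma classL_strict (R : realType) (g : R -> R) (u v : R) :
  classL g -> 0 < u -> u < v -> g v <= g u -> 0 < g u.
Proof.
move=> gL u0 uv gvu; have [gm _ _] := gL.
have v0 : 0 < v := lt_trans u0 uv.
have [m hm] := operator_monotone_supergradient gm v0.
have := classL_gt0 gL (_ : 1 < v + 1); rewrite ltrDr => /(_ v0).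
have := hm (v + 1) (addr_gt0 v0 ltr01); have := hm u u0; nra.
Qed.

(** * The scalar Karcher equation *)

Section ScalarKarcher.
Context {R : realType} {n : nat} (g : R -> R) (w a : 'I_n -> R).
Hypotheses (gL : classL g) (wW : weight_vector w) (a0 : forall i, 0 < a i).

Lemma weight_vector_index : exists i : 'I_n, True.
Proof.
case: n w wW => [|m] v [_ v1]; last by exists ord0.
by move: v1; rewrite big_ord0 => /eqP; rewrite eq_sym oner_eq0.
Qed.

(** If [t < s], each term at [s] is at most the one at [t], and the sums force termwise equality. By
    [classL_strict] all terms are then positive, so the sum at [t] cannot be 0. *)
Lemma karcher_num_le (s t : R) : 0 < s -> 0 < t ->
  0 <= \sum_i w i * g (a i / s) -> \sum_i w i * g (a i / t) = 0 -> s <= t.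
Proof.
move=> s0 t0 Fs Ft; rewrite leNgt; apply/negP => ts.
have [gm _ _] := gL; have [w0 _] := wW.
have ast i : a i / s < a i / t by rewrite ltr_pM2l // ltf_pV2.
have as0 i : 0 < a i / s by rewrite divr_gt0.
have gst i : g (a i / s) <= g (a i / t).
  by apply: operator_monotone_nondecreasing => //; exact: ltW.
have diff0 i : 0 <= w i * (g (a i / t) - g (a i / s)).
  by rewrite mulr_ge0 ?subr_ge0 // ltW.
have sum0 : \sum_i w i * (g (a i / t) - g (a i / s)) = 0.
  apply/eqP; rewrite eq_le sumr_ge0 // andbT.
  under eq_bigr do rewrite mulrBr.
  by rewrite sumrB Ft sub0r oppr_le0.
have gs i : 0 < g (a i / s).
  apply: (classL_strict gL (as0 i) (ast i)).
  have /(_ i isT)/eqP := psumr_eq0P (fun i _ => diff0 i) sum0.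
  by rewrite mulf_eq0 gt_eqF //= subr_eq0 => /eqP ->.
have [i _] := weight_vector_index.
suff : 0 < \sum_i w i * g (a i / t) by rewrite Ft ltxx.
rewrite (bigD1 i) //= ltr_pwDl //; first by rewrite mulr_gt0 // (lt_le_trans (gs i)).
by rewrite sumr_ge0 // => j _; rewrite mulr_ge0 ?ltW // (lt_le_trans (gs j)).
Qed.

Lemma karcher_num_exists : exists2 t, 0 < t & \sum_i w i * g (a i / t) = 0.
Proof.
have [gm g1 _] := gL; have [w0 _] := wW; have [i0 _] := weight_vector_index.
have mono := operator_monotone_nondecreasing gm.
(* The variable is the inverse of the unknown. At [lo] all arguments of [g] are at most 1, at [hi]
   at least 1, so the intermediate value theorem applies. *)
pose F s := \sum_i w i * g (a i * s).
pose lo := (\sum_i a i)^-1; pose hi := \sum_i (a i)^-1.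
have leS i : a i <= \sum_j a j.
  by rewrite (bigD1 i) //= lerDl sumr_ge0 // => j _; rewrite ltW.
have lo0 : 0 < lo by rewrite invr_gt0 (lt_le_trans (a0 i0)).
have lehi i : (a i)^-1 <= hi.
  by rewrite /hi (bigD1 i) //= lerDl sumr_ge0 // => j _; rewrite invr_ge0 ltW.
have lohi : lo <= hi.
  apply: le_trans (lehi i0); rewrite lef_pV2 ?posrE //.
  exact: lt_le_trans (leS i0).
have Flo : F lo <= 0.
  rewrite /F -oppr_ge0 -sumrN sumr_ge0 // => i _.
  rewrite oppr_ge0 pmulr_rle0 // -g1; apply: mono; first by rewrite mulr_gt0.
  by rewrite ler_pdivrMr ?mul1r // (lt_le_trans (a0 i0)).
have Fhi : 0 <= F hi.
  rewrite sumr_ge0 // => i _.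
  rewrite pmulr_rge0 // -g1; apply: mono => //.
  by rewrite -[leLHS](mulfV (lt0r_neq0 (a0 i))) ler_pM2l.
have Fc : {within `[lo, hi], continuous F}.
  apply: continuous_in_subspaceT => s; rewrite inE /= in_itv /= => /andP[los _].
  have s0 : 0 < s := lt_le_trans lo0 los.
  apply: cvg_big => [|i _]; first exact: add_continuous.
  apply: cvgM; first exact: cvg_cst.
  apply: (@continuous_comp _ _ _ ( *%R (a i)) g); first exact: mulrl_continuous.
  by apply: operator_monotone_continuous; rewrite ?mulr_gt0.
have [|s] := IVT lohi Fc (v := 0).
  by rewrite ge_min Flo le_max Fhi orbT.
rewrite in_itv /= => /andP[los _] Fs.
exists s^-1; first by rewrite invr_gt0 (lt_le_trans lo0).
by rewrite -[RHS]Fs; apply: eq_bigr => i _; rewrite invrK.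
Qed.

End ScalarKarcher.

(** * Jensen's inequality for quadratic forms, and the comparison of solutions *)

(** Scalar Jensen in an eigenbasis of [B], weighted by the squared moduli of the coordinates of [x],
    whose sum is [s]. *)
Lemma inner_fcalc_le (R : realType) (g : R -> R) k (B : 'M[R[i]]_k) (x : 'cV_k)
    (s b : R) :
  operator_monotone g -> posdefmx B -> x != 0 ->
  inner x x = s%:C -> inner (B *m x) x = b%:C ->
  inner (fcalc g B *m x) x <= (s * g (b / s))%:C.
Proof.
move=> gm /posdef_udiagP[V [d Vu [-> d0]]] x0.
rewrite inner_self -(sum_sqmod_unitary x Vu) => /complexI <-.
rewrite inner_udiag => /complexI <-.
rewrite fcalc_udiag // inner_udiag lecR.
have -> : \sum_j (g \o d) j * sqmod ((V *m x) j 0)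
    = \sum_j sqmod ((V *m x) j 0) * g (d j) by apply: eq_bigr => j _; rewrite mulrC.
have -> : \sum_j d j * sqmod ((V *m x) j 0)
    = \sum_j sqmod ((V *m x) j 0) * d j by apply: eq_bigr => j _; rewrite mulrC.
apply: operator_monotone_jensen => // [j|]; first exact: sqmod_ge0.
by rewrite sum_sqmod_unitary // sum_sqmod_gt0.
Qed.

Lemma udiag_mul (R : realType) k (V : 'M[R[i]]_k) d e :
  V \is unitarymx -> udiag V d *m udiag V e = udiag V (fun j => d j * e j).
Proof.
move=> Vu; rewrite /udiag -!mulmxA [V *m (V^t* *m _)]mulmxA (unitarymxP Vu).
rewrite mul1mx [diag_mx _ *m (diag_mx _ *m V)]mulmxA mulmx_diag.
by congr (V^t* *m (diag_mx _ *m V)); apply/matrixP => a b; rewrite !mxE rmorphM.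
Qed.

Lemma udiag_const (R : realType) k (V : 'M[R[i]]_k) (c : R) :
  V \is unitarymx -> udiag V (fun _ => c) = (c%:C)%:M.
Proof.
move=> Vu; rewrite /udiag (_ : \row_j _ = const_mx c%:C); last first.
  by apply/matrixP => a b; rewrite !mxE.
by rewrite diag_const_mx scalar_mxC -mulmxA unitary_adjmxK // mulmx1.
Qed.

Lemma fcalc_scalar (R : realType) k (f : R -> R) (c : R) :
  fcalc f ((c%:C)%:M : 'M[R[i]]_k) = ((f c)%:C)%:M.
Proof.
have Iu := unitarymx1 R k.
by rewrite -(udiag_const c Iu) fcalc_udiag // -(udiag_const (f c) Iu).
Qed.

(** The witness [T] is the positive square root of [X], diagonal in the same basis as
    [invsqrtmx X]. *)
Lemma posdef_invsqrtmx (R : realType) k (X : 'M[R[i]]_k) : posdefmx X ->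
  exists T : 'M[R[i]]_k, [/\ T^t* = T, T *m T = X, (invsqrtmx X)^t* = invsqrtmx X,
    invsqrtmx X *m T = 1%:M & T *m invsqrtmx X = 1%:M].
Proof.
move=> /posdef_udiagP[V [d Vu [-> d0]]].
have adj e : (udiag V e)^t* = udiag V e.
  by have /is_hermitianmxP := udiag_herm V e; rewrite expr0 scale1r.
have n0 j : Num.sqrt (d j) != 0 by rewrite gt_eqF // sqrtr_gt0.
have one e : (forall j, e j = 1) -> udiag V e = 1%:M.
  by move=> e1; rewrite (_ : e = fun _ => 1) ?udiag_const //; exact: funext.
have -> : invsqrtmx (udiag V d) = udiag V (fun j => (Num.sqrt (d j))^-1).
  exact: fcalc_udiag.
exists (udiag V (fun j => Num.sqrt (d j))); split.
- exact: adj.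
- rewrite (udiag_mul _ _ Vu); congr udiag; apply: funext => j.
  by rewrite -expr2 sqr_sqrtr // ltW.
- exact: adj.
- by rewrite (udiag_mul _ _ Vu); apply: one => j; rewrite mulVf.
- by rewrite (udiag_mul _ _ Vu); apply: one => j; rewrite mulfV.
Qed.

Lemma posdef_congr (R : realType) k (A S T : 'M[R[i]]_k) :
  posdefmx A -> S^t* = S -> T *m S = 1%:M -> posdefmx (S *m A *m S).
Proof.
move=> [Ah Ap] Sh TS; split=> [|x x0].
  have /is_hermitianmxP := Ah; rewrite expr0 scale1r => AE.
  apply/is_hermitianmxP; rewrite expr0 scale1r !trmx_mul !map_mxM /=.
  by rewrite Sh -AE mulmxA.
rewrite -!mulmxA inner_mulmxl Sh; apply: Ap.
by apply: contra x0 => /eqP Sx; rewrite -(mul1mx x) -TS -mulmxA Sx mulmx0.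
Qed.

Lemma posdef_inner_real (R : realType) k (A : 'M[R[i]]_k) (x : 'cV_k) :
  posdefmx A -> x != 0 ->
  exists2 a : R, 0 < a & inner (A *m x) x = a%:C.
Proof.
move=> [_ Ap] x0; have /complex_realP[a aE] := gtr0_real (Ap x x0).
by exists a => //; have := Ap x x0; rewrite aE ltcR.
Qed.

(** Every matrix involved is scalar, and conjugating [a i] by the inverse square root of [t] gives
    [a i / t]. *)
Lemma karcher_solution_num (R : realType) n (g : R -> R) (w a : 'I_n -> R)
    (X : 'M[R[i]]_1) :
  karcher_solution g w (fun i => ((a i)%:C)%:M) X <->
  exists2 t, 0 < t & X = (t%:C)%:M /\ \sum_i w i * g (a i / t) = 0.
Proof.
have solE t : 0 < t ->
    \sum_i (w i)%:C *: fcalc g (invsqrtmx (t%:C)%:M *m (a i)%:C%:M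
        *m invsqrtmx (t%:C)%:M) = ((\sum_i w i * g (a i / t))%:C)%:M :> 'M[R[i]]_1.
  move=> t0; rewrite rmorph_sum raddf_sum /=; apply: eq_bigr => i _.
  rewrite /invsqrtmx fcalc_scalar -!scalar_mxM -!rmorphM /= fcalc_scalar.
  rewrite scale_scalar_mx -rmorphM; congr ((w i * g _)%:C%:M).
  by rewrite mulrAC -invfM -expr2 sqr_sqrtr ?ltW // mulrC.
split=> [[Xp Xs]|[t t0 [-> Ft]]].
  have one0 : (1%:M : 'cV[R[i]]_1) != 0 by rewrite -scalemx1 scale1r oner_neq0.
  have [t t0] := posdef_inner_real Xp one0.
  rewrite innerE trmx1 map_mx1 mul1mx mulmx1 => Xt.
  have XE : X = (t%:C)%:M by rewrite [X]mx11_scalar Xt.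
  exists t => //; split=> //; move: Xs; rewrite XE solE // => /matrixP/(_ 0 0).
  by rewrite !mxE => /complexI.
split; last by rewrite solE // Ft; exact: raddf0.
by rewrite -(udiag_const t (unitarymx1 R 1)); apply: posdef_udiag; rewrite ?unitarymx1.
Qed.

Theorem theorem3p3 (R : realType) (g : R -> R) (n k : nat)
    (A : 'I_n -> 'M[R[i]]_k) (w : 'I_n -> R) :
  classL g -> (forall i, posdefmx (A i)) -> weight_vector w ->
  forall x : 'cV[R[i]]_k,
    inner (sigma g w A *m x) x
      <= (if x == 0 then 0 else sigma_num g w (fun i => inner (A i *m x) x)).
Proof.
move=> gL Ap wW x; case: ifPn => [/eqP ->|x0].
  by rewrite mulmx0 innerE mulmx0 mxE.
have [gm _ _] := gL; have [w0 _] := wW.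
have /choice[a /all_and2[a0 aE]] : forall i, exists b : R,
    0 < b /\ inner (A i *m x) x = b%:C.
  by move=> i; have [b] := posdef_inner_real (Ap i) x0; exists b.
have [t t0 [sE Ft]] : exists2 t, 0 < t &
    sigma_num g w (fun i => inner (A i *m x) x) = t%:C
    /\ \sum_i w i * g (a i / t) = 0.
  have [u u0 Fu] := karcher_num_exists gL wW a0.
  rewrite (funext aE) /sigma_num /sigma.
  (* Existence of the root [u] ensures that [xget] returns a genuine solution, which supplies
     [t]. *)
  have /(xgetPex 0)/karcher_solution_num[t t0 [-> Ft]] :
      exists X, karcher_solution g w (fun i => (a i)%:C%:M : 'M[R[i]]_1) X.
    by exists (u%:C)%:M; apply/karcher_solution_num; exists u.
  by exists t => //; split=> //; rewrite mxE.
(* In the branch where [xget] returns its default 0, the claim reduces to [0 <= t]. *)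
rewrite sE /sigma; case: xgetP => [X _ [Xp Xs]|_]; last first.
  by rewrite mul0mx innerE mulmx0 mxE ler0c ltW.
have [T [Th TT Sh ST TS]] := posdef_invsqrtmx Xp.
move: (invsqrtmx X) Xs Sh ST TS => S Xs Sh ST TS.
have [y yE] : exists y, y = T *m x by exists (T *m x).
have Sy : S *m y = x by rewrite yE mulmxA ST mul1mx.
have y0 : y != 0 by apply: contra x0 => /eqP y0; rewrite -Sy y0 mulmx0.
have Xx : inner (X *m x) x = inner y y by rewrite -TT -mulmxA inner_mulmxl Th yE.
have Bp i : posdefmx (S *m A i *m S) := posdef_congr (Ap i) Sh TS.
have By i : inner (S *m A i *m S *m y) y = (a i)%:C.
  by rewrite -!(mulmxA S) -(mulmxA (A i)) Sy inner_mulmxl Sh Sy.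
have s0 := sum_sqmod_gt0 y0.
rewrite Xx inner_self lecR.
apply: (karcher_num_le gL wW a0 s0 t0 _ Ft).
set s := \sum_j _ in s0 *.
(* After scaling by [s], the left-hand 0 becomes the form of the Karcher sum at [y], and
   [inner_fcalc_le] compares the two sides term by term. *)
rewrite -(pmulr_rge0 _ s0) mulr_sumr -lecR.
have <- : inner ((\sum_i (w i)%:C *: fcalc g (S *m A i *m S)) *m y) y = 0%:C.
  by rewrite Xs mul0mx innerE mulmx0 mxE.
rewrite mulmx_suml innerE mulmx_sumr summxE rmorph_sum; apply: ler_sum => i _.
rewrite -scalemxAl -scalemxAr mxE -innerE mulrCA rmorphM.
apply: ler_wpM2l; first by rewrite ler0c ltW.
exact: inner_fcalc_le gm (Bp i) y0 (inner_self y) (By i).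
Qed.
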